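(* Let $\mathbb{X}$ be a differential category with differential modality $(\mathsf{S},\mu,\eta,\mathsf{m},\mathsf{u},\mathsf{d})$ and with finite biproducts. Let $\mathsf{S}\text{-}\mathsf{DER}_{\text{free}}$ be the full subcategory of $\mathsf{S}\text{-}\mathsf{DER}$ on the $\mathsf{S}$-derivations of the form $$(1_{\mathsf{S}(A_0)}\otimes\phi)\circ\mathsf{d}_{A_0}\colon(\mathsf{S}(A_0),\mu_{A_0})\to(\mathsf{S}(A_0)\otimes A_1,\mathsf{m}_{A_0}\otimes 1_{A_1})$$ for some map $\phi\colon A_0\to A_1$ of $\mathbb{X}$. Then the opposite category of $\mathsf{S}\text{-}\mathsf{DER}_{\text{free}}$ is a cartesian differential category.
   Context: Symmetric monoidal categories $(\mathbb{X},\otimes,I)$ are written as strict (associators and unitors treated as identities), with symmetry $\sigma_{A,B}\colon A\otimes B\to B\otimes A$. An additive category is a category enriched over commutative monoids: each hom-set is a commutative monoid $(+,0)$ and composition preserves $+$ and $0$ in each argument (no negatives assumed). An additive symmetric monoidal category is a symmetric monoidal category that is additive and such that $\otimes$ of maps preserves $+$ and $0$ in each argument. An algebra modality on a symmetric monoidal category is $(\mathsf{S},\mu,\eta,\mathsf{m},\mathsf{u})$ where $(\mathsf{S},\mu,\eta)$ is a monad ($\mu_A\colon\mathsf{S}\mathsf{S}(A)\to\mathsf{S}(A)$, $\eta_A\colon A\to\mathsf{S}(A)$) and $\mathsf{m}_A\colon\mathsf{S}(A)\otimes\mathsf{S}(A)\to\mathsf{S}(A)$, $\mathsf{u}_A\colon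 I\to\mathsf{S}(A)$ are natural transformations such that each $(\mathsf{S}(A),\mathsf{m}_A,\mathsf{u}_A)$ is a commutative monoid and each $\mu_A$ is a monoid morphism $(\mathsf{S}\mathsf{S}(A),\mathsf{m}_{\mathsf{S}(A)},\mathsf{u}_{\mathsf{S}(A)})\to(\mathsf{S}(A),\mathsf{m}_A,\mathsf{u}_A)$. A differential modality on an additive symmetric monoidal category is an algebra modality with a natural transformation $\mathsf{d}_A\colon\mathsf{S}(A)\to\mathsf{S}(A)\otimes A$ (the deriving transformation) such that [D.1] $\mathsf{d}_A\circ\mathsf{u}_A=0$; [D.2] $\mathsf{d}_A\circ\mathsf{m}_A=(\mathsf{m}_A\otimes 1_A)\circ\big((1_{\mathsf{S}(A)}\otimes\mathsf{d}_A)+(1_{\mathsf{S}(A)}\otimes\sigma_{A,\mathsf{S}(A)})\circ(\mathsf{d}_A\otimes 1_{\mathsf{S}(A)})\big)$; [D.3] $\mathsf{d}_A\circ\eta_A=\mathsf{u}_A\otimes 1_A$; [D.4] $\mathsf{d}_A\circ\mu_A=(\mathsf{m}_A\otimes 1_A)\circ(\mu_A\otimes\mathsf{d}_A)\circ\mathsf{d}_{\mathsf{S}(A)}$; [D.5] $(1_{\mathsf{S}(A)}\otimes\sigma_{A,A})\circ(\mathsf{d}_A\otimes 1_A)\circ\mathsf{d}_A=(\mathsf{d}_A\otimes 1_A)\circ\mathsf{d}_A$. A differential category is an additive symmetric monoidal category equipped with a differential modality. $\mathsf{S}$-algebras and their morphisms are the Eilenberg–Moore ones. Every $\mathsf{S}$-algebra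 $(A,\nu)$ carries a commutative monoid structure $(A,\mathsf{m}^\nu,\mathsf{u}^\nu)$ with $\mathsf{m}^\nu=\nu\circ\mathsf{m}_A\circ(\eta_A\otimes\eta_A)$ and $\mathsf{u}^\nu=\nu\circ\mathsf{u}_A$ (for the free algebra $(\mathsf{S}(A),\mu_A)$ this is $(\mathsf{S}(A),\mathsf{m}_A,\mathsf{u}_A)$). A module over a commutative monoid $(A,\mathsf{m},\mathsf{u})$ is $(M,\alpha\colon A\otimes M\to M)$ with $\alpha\circ(1_A\otimes\alpha)=\alpha\circ(\mathsf{m}\otimes 1_M)$ and $\alpha\circ(\mathsf{u}\otimes 1_M)=1_M$; an $(A,\nu)$-module means an $(A,\mathsf{m}^\nu,\mathsf{u}^\nu)$-module. An $\mathsf{S}$-derivation $\mathsf{D}\colon(A,\nu)\to(M,\alpha)$, for an $\mathsf{S}$-algebra $(A,\nu)$ and an $(A,\nu)$-module $(M,\alpha)$, is a map $\mathsf{D}\colon A\to M$ with $\mathsf{D}\circ\nu=\alpha\circ(\nu\otimes\mathsf{D})\circ\mathsf{d}_A$. An $\mathsf{S}$-derivation morphism from $\mathsf{D}\colon(A,\nu)\to(M,\alpha)$ to $\mathsf{D}'\colon(A',\nu')\to(M',\alpha')$ is a pair $(f,g)$ with $f\colon(A,\nu)\to(A',\nu')$ an $\mathsf{S}$-algebra morphism and $g\colon M\to M'$ a map such that $g\circ\alpha=\alpha'\circ(f\otimes g)$ and $g\circ\mathsf{D}=\mathsf{D}'\circ f$. These form the category $\mathsf{S}\text{-}\mathsf{DER}$.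 Cartesian differential category (Blute–Cockett–Seely): a category with finite products $\times$ (projections $\pi_1,\pi_2$), each hom-set a commutative monoid $(+,0)$ with $(f+g)\circ h=f\circ h+g\circ h$ and $0\circ h=0$, with $\pi_i\circ(f+g)=\pi_i\circ f+\pi_i\circ g$ and $\pi_i\circ 0=0$, together with a differential combinator sending each $f\colon A\to B$ to $\mathsf{D}[f]\colon A\times A\to B$ such that: (1) $\mathsf{D}[f+g]=\mathsf{D}[f]+\mathsf{D}[g]$, $\mathsf{D}[0]=0$; (2) $\mathsf{D}[f]\circ\langle a,b+b'\rangle=\mathsf{D}[f]\circ\langle a,b\rangle+\mathsf{D}[f]\circ\langle a,b'\rangle$, $\mathsf{D}[f]\circ\langle a,0\rangle=0$; (3) $\mathsf{D}[1]=\pi_2$, $\mathsf{D}[\pi_i]=\pi_i\circ\pi_2$; (4) $\mathsf{D}[\langle f,g\rangle]=\langle\mathsf{D}[f],\mathsf{D}[g]\rangle$; (5) $\mathsf{D}[g\circ f]=\mathsf{D}[g]\circ\langle f\circ\pi_1,\mathsf{D}[f]\rangle$; (6) $\mathsf{D}[\mathsf{D}[f]]\circ\langle\langle a,b\rangle,\langle 0,e\rangle\rangle=\mathsf{D}[f]\circ\langle a,e\rangle$; (7) $\mathsf{D}[\mathsf{D}[f]]\circ\langle\langle a,b\rangle,\langle e,h\rangle\rangle=\mathsf{D}[\mathsf{D}[f]]\circ\langle\langle a,e\rangle,\langle b,h\rangle\rangle$. (Here the first argument of $\mathsf{D}[f]$ is the point and the second the direction.) *)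

(* Defs.v *)
From Stdlib Require Import ProofIrrelevance.
From mathcomp Require Import ssreflect ssrfun ssrbool.

Set Implicit Arguments.
Unset Strict Implicit.
Unset Printing Implicit Defensive.

Declare Scope cat_scope.
Delimit Scope cat_scope with cat.
Local Open Scope cat_scope.

Reserved Notation "g ∘ f" (at level 40, left associativity).
Reserved Notation "f ⊗ g" (at level 38, left associativity).
Reserved Notation "A ⊠ B" (at level 38, left associativity).
Reserved Notation "⟨ f , g ⟩" (at level 0, f, g at level 99).

Record Category := {
  ob :> Type;
  hom : ob -> ob -> Type;
  idm : forall A, hom A A;
  comp : forall A B C, hom B C -> hom A B -> hom A C;
  comp_idl : forall A B (f : hom A B), comp (idm B) f = f;
  comp_idr : forall A B (f : hom A B), comp f (idm A) = f;
  comp_assoc : forall A B C D (h : hom C D) (g : hom B C) (f : hom A B),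
    comp h (comp g f) = comp (comp h g) f
}.
Arguments hom {c} _ _.
Arguments idm {c} _.
Arguments comp {c A B C} _ _.
Notation "g ∘ f" := (comp g f) : cat_scope.
Notation "1_( A )" := (idm A) (format "1_( A )") : cat_scope.

Definition opposite (C : Category) : Category := {|
  ob := ob C;
  hom := fun A B => @hom C B A;
  idm := fun A => idm A;
  comp := fun A B D (g : @hom C D B) (f : @hom C B A) => f ∘ g;
  comp_idl := fun A B f => comp_idr f;
  comp_idr := fun A B f => comp_idl f;
  comp_assoc := fun A B D E h g f => esym (comp_assoc f g h)
|}.

Definition full_subcategory (C : Category) (P : C -> Prop) : Category := {|
  ob := {A : C | P A};
  hom := fun A B => @hom C (sval A) (sval B);
  idm := fun A => 1_(sval A);
  comp := fun A B D g f => g ∘ f;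
  comp_idl := fun A B f => comp_idl f;
  comp_idr := fun A B f => comp_idr f;
  comp_assoc := fun A B D E h g f => comp_assoc h g f
|}.

Record Endofunctor (C : Category) := {
  fobj :> C -> C;
  fmap : forall A B, hom A B -> hom (fobj A) (fobj B);
  fmap_id : forall A, fmap 1_(A) = 1_(fobj A);
  fmap_comp : forall A B D (g : hom B D) (f : hom A B),
    fmap (g ∘ f) = fmap g ∘ fmap f
}.
Arguments fmap {C} e {A B} _.

Record Monad (C : Category) := {
  monad_functor :> Endofunctor C;
  mu : forall A, hom (monad_functor (monad_functor A)) (monad_functor A);
  eta : forall A, hom A (monad_functor A);
  mu_natural : forall A B (f : hom A B),
    mu B ∘ fmap monad_functor (fmap monad_functor f)
    = fmap monad_functor f ∘ mu A;
  eta_natural : forall A B (f : hom A B),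
    eta B ∘ f = fmap monad_functor f ∘ eta A;
  mu_eta : forall A, mu A ∘ eta (monad_functor A) = 1_(monad_functor A);
  mu_fmap_eta : forall A,
    mu A ∘ fmap monad_functor (eta A) = 1_(monad_functor A);
  mu_assoc : forall A,
    mu A ∘ fmap monad_functor (mu A) = mu A ∘ mu (monad_functor A)
}.
Arguments mu {C} m A.
Arguments eta {C} m A.

(** "Additive" means enriched over commutative monoids, without negatives. *)
Class Additive (C : Category) := {
  madd : forall {A B : C}, hom A B -> hom A B -> hom A B;
  mzero : forall {A B : C}, hom A B;
  maddA : forall A B : C, associative (@madd A B);
  maddC : forall A B : C, commutative (@madd A B);
  madd0 : forall A B : C, left_id (@mzero A B) (@madd A B);
  comp_addl : forall (A B D : C) (g h : hom B D) (f : hom A B),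
    madd g h ∘ f = madd (g ∘ f) (h ∘ f);
  comp_addr : forall (A B D : C) (h : hom B D) (f g : hom A B),
    h ∘ madd f g = madd (h ∘ f) (h ∘ g);
  comp_zerol : forall (A B D : C) (f : hom A B),
    (mzero : hom B D) ∘ f = mzero;
  comp_zeror : forall (A B D : C) (h : hom B D),
    h ∘ (mzero : hom A B) = mzero
}.
Notation "f + g" := (madd f g) : cat_scope.
Notation "0" := mzero : cat_scope.

(** The associator [assoc], the unitors [lunit], [runit] and their inverses
    are explicit: strictness is not assumed. *)
Class SymmetricMonoidal (C : Category) := {
  tens : C -> C -> C;
  tensm : forall {A B A' B' : C},
    hom A A' -> hom B B' -> hom (tens A B) (tens A' B');
  unitI : C;
  assoc : forall A B D : C, hom (tens (tens A B) D) (tens A (tens B D));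
  assoc_inv : forall A B D : C, hom (tens A (tens B D)) (tens (tens A B) D);
  lunit : forall A : C, hom (tens unitI A) A;
  lunit_inv : forall A : C, hom A (tens unitI A);
  runit : forall A : C, hom (tens A unitI) A;
  runit_inv : forall A : C, hom A (tens A unitI);
  sym : forall A B : C, hom (tens A B) (tens B A);
  tensm_id : forall A B : C, tensm 1_(A) 1_(B) = 1_(tens A B);
  tensm_comp : forall (A B D A' B' D' : C) (g : hom B D) (f : hom A B)
      (g' : hom B' D') (f' : hom A' B'),
    tensm (g ∘ f) (g' ∘ f') = tensm g g' ∘ tensm f f';
  assocK : forall A B D : C, assoc_inv A B D ∘ assoc A B D = 1_(_);
  assoc_invK : forall A B D : C, assoc A B D ∘ assoc_inv A B D = 1_(_);
  lunitK : forall A : C, lunit_inv A ∘ lunit A = 1_(_);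
  lunit_invK : forall A : C, lunit A ∘ lunit_inv A = 1_(_);
  runitK : forall A : C, runit_inv A ∘ runit A = 1_(_);
  runit_invK : forall A : C, runit A ∘ runit_inv A = 1_(_);
  symK : forall A B : C, sym B A ∘ sym A B = 1_(_);
  assoc_natural : forall (A B D A' B' D' : C)
      (f : hom A A') (g : hom B B') (h : hom D D'),
    assoc A' B' D' ∘ tensm (tensm f g) h
    = tensm f (tensm g h) ∘ assoc A B D;
  lunit_natural : forall (A B : C) (f : hom A B),
    lunit B ∘ tensm 1_(unitI) f = f ∘ lunit A;
  runit_natural : forall (A B : C) (f : hom A B),
    runit B ∘ tensm f 1_(unitI) = f ∘ runit A;
  sym_natural : forall (A B A' B' : C) (f : hom A A') (g : hom B B'),
    sym A' B' ∘ tensm f g = tensm g f ∘ sym A B;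
  triangle : forall A B : C,
    tensm 1_(A) (lunit B) ∘ assoc A unitI B = tensm (runit A) 1_(B);
  pentagon : forall A B D E : C,
    assoc A B (tens D E) ∘ assoc (tens A B) D E
    = tensm 1_(A) (assoc B D E) ∘ assoc A (tens B D) E
      ∘ tensm (assoc A B D) 1_(E);
  hexagon : forall A B D : C,
    assoc B D A ∘ sym A (tens B D) ∘ assoc A B D
    = tensm 1_(B) (sym A D) ∘ assoc B A D ∘ tensm (sym A B) 1_(D)
}.
Notation "A ⊠ B" := (tens A B) : cat_scope.
Notation "f ⊗ g" := (tensm f g) : cat_scope.

Class AdditiveSymmetricMonoidal (C : Category)
    (addC : Additive C) (monC : SymmetricMonoidal C) : Prop := {
  tensm_addl : forall (A B A' B' : C) (f g : hom A A') (h : hom B B'),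
    (f + g) ⊗ h = f ⊗ h + g ⊗ h;
  tensm_addr : forall (A B A' B' : C) (f : hom A A') (g h : hom B B'),
    f ⊗ (g + h) = f ⊗ g + f ⊗ h;
  tensm_zerol : forall (A B A' B' : C) (h : hom B B'),
    (0 : hom A A') ⊗ h = 0;
  tensm_zeror : forall (A B A' B' : C) (f : hom A A'),
    f ⊗ (0 : hom B B') = 0
}.

Record FiniteBiproducts (C : Category) {addC : Additive C} := {
  zero_ob : C;
  zero_ob_id : 1_(zero_ob) = 0;
  biprod : C -> C -> C;
  bproj1 : forall A B, hom (biprod A B) A;
  bproj2 : forall A B, hom (biprod A B) B;
  binj1 : forall A B, hom A (biprod A B);
  binj2 : forall A B, hom B (biprod A B);
  bproj1_inj1 : forall A B, bproj1 A B ∘ binj1 A B = 1_(A);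
  bproj1_inj2 : forall A B, bproj1 A B ∘ binj2 A B = 0;
  bproj2_inj1 : forall A B, bproj2 A B ∘ binj1 A B = 0;
  bproj2_inj2 : forall A B, bproj2 A B ∘ binj2 A B = 1_(B);
  biprod_id : forall A B,
    binj1 A B ∘ bproj1 A B + binj2 A B ∘ bproj2 A B = 1_(biprod A B)
}.

Arguments FiniteBiproducts C {addC}.

Section Monoids.
Context {C : Category} {monC : SymmetricMonoidal C}.

Record is_commutative_monoid (A : C) (m : hom (A ⊠ A) A) (u : hom unitI A)
    : Prop := {
  cmon_assoc : m ∘ (m ⊗ 1_(A)) = m ∘ (1_(A) ⊗ m) ∘ assoc A A A;
  cmon_unitl : m ∘ (u ⊗ 1_(A)) = lunit A;
  cmon_unitr : m ∘ (1_(A) ⊗ u) = runit A;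
  cmon_comm : m ∘ sym A A = m
}.

Record is_monoid_morphism (A : C) (m : hom (A ⊠ A) A) (u : hom unitI A)
    (B : C) (m' : hom (B ⊠ B) B) (u' : hom unitI B) (f : hom A B) : Prop := {
  monm_mul : f ∘ m = m' ∘ (f ⊗ f);
  monm_unit : f ∘ u = u'
}.

Record is_module (A : C) (m : hom (A ⊠ A) A) (u : hom unitI A)
    (M : C) (act : hom (A ⊠ M) M) : Prop := {
  mod_assoc : act ∘ (1_(A) ⊗ act) ∘ assoc A A M = act ∘ (m ⊗ 1_(M));
  mod_unit : act ∘ (u ⊗ 1_(M)) = lunit M
}.

End Monoids.

Record AlgebraModality (C : Category) {monC : SymmetricMonoidal C} := {
  am_monad :> Monad C;
  mm : forall A, hom (am_monad A ⊠ am_monad A) (am_monad A);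
  uu : forall A, hom unitI (am_monad A);
  mm_natural : forall A B (f : hom A B),
    mm B ∘ (fmap am_monad f ⊗ fmap am_monad f) = fmap am_monad f ∘ mm A;
  uu_natural : forall A B (f : hom A B), fmap am_monad f ∘ uu A = uu B;
  am_cmonoid : forall A, is_commutative_monoid (mm A) (uu A);
  am_mu_morphism : forall A,
    is_monoid_morphism (mm (am_monad A)) (uu (am_monad A)) (mm A) (uu A)
      (mu am_monad A)
}.
Arguments AlgebraModality C {monC}.
Arguments mm {C monC} a A.
Arguments uu {C monC} a A.

Record DifferentialModality (C : Category) {addC : Additive C}
    {monC : SymmetricMonoidal C} := {
  dm_modality :> AlgebraModality C;
  dd : forall A, hom (dm_modality A) (dm_modality A ⊠ A);
  dd_natural : forall A B (f : hom A B),
    dd B ∘ fmap dm_modality f = (fmap dm_modality f ⊗ f) ∘ dd A;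
  dd_constant : forall A, dd A ∘ uu dm_modality A = 0;
  dd_product : forall A,
    dd A ∘ mm dm_modality A
    = (mm dm_modality A ⊗ 1_(A))
      ∘ assoc_inv (dm_modality A) (dm_modality A) A
      ∘ (1_(dm_modality A) ⊗ dd A
         + (1_(dm_modality A) ⊗ sym A (dm_modality A))
           ∘ assoc (dm_modality A) A (dm_modality A)
           ∘ (dd A ⊗ 1_(dm_modality A)));
  dd_linear : forall A,
    dd A ∘ eta dm_modality A = (uu dm_modality A ⊗ 1_(A)) ∘ lunit_inv A;
  dd_chain : forall A,
    dd A ∘ mu dm_modality A
    = (mm dm_modality A ⊗ 1_(A))
      ∘ assoc_inv (dm_modality A) (dm_modality A) A
      ∘ (mu dm_modality A ⊗ dd A)
      ∘ dd (dm_modality A);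
  dd_interchange : forall A,
    (1_(dm_modality A) ⊗ sym A A) ∘ assoc (dm_modality A) A A
      ∘ (dd A ⊗ 1_(A)) ∘ dd A
    = assoc (dm_modality A) A A ∘ (dd A ⊗ 1_(A)) ∘ dd A
}.
Arguments DifferentialModality C {addC monC}.
Arguments dd {C addC monC} d A.

Section Derivations.
Context {X : Category} {addX : Additive X} {monX : SymmetricMonoidal X}.
Variable S : DifferentialModality X.

Record is_algebra (A : X) (nu : hom (S A) A) : Prop := {
  alg_eta : nu ∘ eta S A = 1_(A);
  alg_mu : nu ∘ mu S A = nu ∘ fmap S nu
}.

Definition alg_mul (A : X) (nu : hom (S A) A) : hom (A ⊠ A) A :=
  nu ∘ mm S A ∘ (eta S A ⊗ eta S A).

Definition alg_unit (A : X) (nu : hom (S A) A) : hom unitI A := nu ∘ uu S A.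

Record DerivationData := {
  der_alg : X;
  der_nu : hom (S der_alg) der_alg;
  der_mod : X;
  der_act : hom (der_alg ⊠ der_mod) der_mod;
  der_map : hom der_alg der_mod
}.

Record is_derivation (E : DerivationData) : Prop := {
  der_is_algebra : is_algebra (der_nu E);
  der_is_module :
    is_module (alg_mul (der_nu E)) (alg_unit (der_nu E)) (der_act E);
  der_chain : der_map E ∘ der_nu E
    = der_act E ∘ (der_nu E ⊗ der_map E) ∘ dd S (der_alg E)
}.

Record Derivation := {
  der_data :> DerivationData;
  derivationP : is_derivation der_data
}.

Record DerivationMorphism (E E' : Derivation) := {
  dmor_alg : hom (der_alg E) (der_alg E');
  dmor_mod : hom (der_mod E) (der_mod E');
  dmor_nu : dmor_alg ∘ der_nu E = der_nu E' ∘ fmap S dmor_alg;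
  dmor_act : dmor_mod ∘ der_act E = der_act E' ∘ (dmor_alg ⊗ dmor_mod);
  dmor_map : dmor_mod ∘ der_map E = der_map E' ∘ dmor_alg
}.

Lemma dmor_eq (E E' : Derivation) (p q : DerivationMorphism E E') :
  dmor_alg p = dmor_alg q -> dmor_mod p = dmor_mod q -> p = q.
Proof.
case: p => f g a b c; case: q => f' g' a' b' c' /= ef eg.
by subst f' g'; congr Build_DerivationMorphism; apply: proof_irrelevance.
Qed.

Definition dmor_id (E : Derivation) : DerivationMorphism E E.
Proof.
by refine {| dmor_alg := 1_(der_alg E); dmor_mod := 1_(der_mod E) |};
  rewrite ?fmap_id ?tensm_id comp_idl comp_idr.
Defined.

Definition dmor_comp (E E' E'' : Derivation) (q : DerivationMorphism E' E'')
  (p : DerivationMorphism E E') : DerivationMorphism E E''.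
Proof.
refine {| dmor_alg := dmor_alg q ∘ dmor_alg p;
          dmor_mod := dmor_mod q ∘ dmor_mod p |}.
- by rewrite fmap_comp -comp_assoc dmor_nu !comp_assoc dmor_nu.
- by rewrite tensm_comp -comp_assoc dmor_act !comp_assoc dmor_act.
- by rewrite -comp_assoc dmor_map !comp_assoc dmor_map.
Defined.

Definition S_DER : Category.
Proof.
refine {| ob := Derivation; hom := DerivationMorphism;
          idm := dmor_id; comp := dmor_comp |}.
- by move=> E E' p; apply: dmor_eq; apply: comp_idl.
- by move=> E E' p; apply: dmor_eq; apply: comp_idr.
- by move=> E E' E'' E''' r q p; apply: dmor_eq; apply: comp_assoc.
Defined.

Definition free_derivation (A0 A1 : X) (phi : hom A0 A1) : DerivationData := {|
  der_alg := S A0;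
  der_nu := mu S A0;
  der_mod := S A0 ⊠ A1;
  der_act := (mm S A0 ⊗ 1_(A1)) ∘ assoc_inv (S A0) (S A0) A1;
  der_map := (1_(S A0) ⊗ phi) ∘ dd S A0
|}.

Definition is_free (E : S_DER) : Prop :=
  exists (A0 A1 : X) (phi : hom A0 A1), der_data E = free_derivation phi.

Definition S_DER_free : Category := full_subcategory is_free.

End Derivations.

Record FiniteProducts (C : Category) := {
  term : C;
  bang : forall A, hom A term;
  bang_unique : forall A (f : hom A term), f = bang A;
  prd : C -> C -> C;
  pr1 : forall A B, hom (prd A B) A;
  pr2 : forall A B, hom (prd A B) B;
  pair : forall X A B, hom X A -> hom X B -> hom X (prd A B);
  pr1_pair : forall X A B (f : hom X A) (g : hom X B), pr1 A B ∘ pair f g = f;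
  pr2_pair : forall X A B (f : hom X A) (g : hom X B), pr2 A B ∘ pair f g = g;
  pair_unique : forall X A B (h : hom X (prd A B)),
    h = pair (pr1 A B ∘ h) (pr2 A B ∘ h)
}.
Arguments prd {C} _ A B.
Arguments pr1 {C} _ {A B}.
Arguments pr2 {C} _ {A B}.
Arguments pair {C} _ {X A B} _ _.

(** Sums are only preserved by precomposition with arbitrary maps, and by
    postcomposition with projections. *)
Record CartesianLeftAdditive (C : Category) := {
  cla_prod :> FiniteProducts C;
  ladd : forall A B : C, hom A B -> hom A B -> hom A B;
  lzero : forall A B : C, hom A B;
  laddA : forall A B, associative (@ladd A B);
  laddC : forall A B, commutative (@ladd A B);
  ladd0 : forall A B, left_id (lzero A B) (@ladd A B);
  ladd_comp : forall A B D (f g : hom B D) (h : hom A B),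
    ladd f g ∘ h = ladd (f ∘ h) (g ∘ h);
  lzero_comp : forall A B D (h : hom A B), lzero B D ∘ h = lzero A D;
  pr1_ladd : forall X A B (f g : hom X (prd cla_prod A B)),
    pr1 cla_prod ∘ ladd f g = ladd (pr1 cla_prod ∘ f) (pr1 cla_prod ∘ g);
  pr2_ladd : forall X A B (f g : hom X (prd cla_prod A B)),
    pr2 cla_prod ∘ ladd f g = ladd (pr2 cla_prod ∘ f) (pr2 cla_prod ∘ g);
  pr1_lzero : forall X A B,
    pr1 cla_prod ∘ lzero X (prd cla_prod A B) = lzero X A;
  pr2_lzero : forall X A B,
    pr2 cla_prod ∘ lzero X (prd cla_prod A B) = lzero X B
}.
Arguments ladd {C} _ {A B} _ _.
Arguments lzero {C} _ {A B}.

Section DifferentialCombinator.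
Variables (C : Category) (L : CartesianLeftAdditive C).
Local Notation "A × B" := (prd L A B) (at level 38, left associativity).
Local Notation "⟨ f , g ⟩" := (pair L f g).
Local Notation π1 := (pr1 L).
Local Notation π2 := (pr2 L).
Local Notation "f +' g" := (ladd L f g) (at level 50, left associativity).
Local Notation "0'" := (lzero L).

(** In [D f : hom (A × A) B] the first factor is the point and the second
    one the direction. *)
Record is_differential_combinator
    (D : forall A B : C, hom A B -> hom (A × A) B) : Prop := {
  cd_add : forall A B (f g : hom A B), D _ _ (f +' g) = D _ _ f +' D _ _ g;
  cd_zero : forall A B, D A B 0' = 0';
  cd_add_dir : forall X A B (f : hom A B) (a b b' : hom X A),
    D _ _ f ∘ ⟨a, b +' b'⟩ = D _ _ f ∘ ⟨a, b⟩ +' D _ _ f ∘ ⟨a, b'⟩;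
  cd_zero_dir : forall X A B (f : hom A B) (a : hom X A),
    D _ _ f ∘ ⟨a, 0'⟩ = 0';
  cd_id : forall A, D A A 1_(A) = π2;
  cd_pr1 : forall A B, D (A × B) A π1 = π1 ∘ π2;
  cd_pr2 : forall A B, D (A × B) B π2 = π2 ∘ π2;
  cd_pair : forall X A B (f : hom X A) (g : hom X B),
    D _ _ ⟨f, g⟩ = ⟨D _ _ f, D _ _ g⟩;
  cd_comp : forall A B E (g : hom B E) (f : hom A B),
    D _ _ (g ∘ f) = D _ _ g ∘ ⟨f ∘ π1, D _ _ f⟩;
  cd_linear : forall X A B (f : hom A B) (a b e : hom X A),
    D _ _ (D _ _ f) ∘ ⟨⟨a, b⟩, ⟨0', e⟩⟩ = D _ _ f ∘ ⟨a, e⟩;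
  cd_symmetric : forall X A B (f : hom A B) (a b e h : hom X A),
    D _ _ (D _ _ f) ∘ ⟨⟨a, b⟩, ⟨e, h⟩⟩ = D _ _ (D _ _ f) ∘ ⟨⟨a, e⟩, ⟨b, h⟩⟩
}.

End DifferentialCombinator.

Record CartesianDifferential (C : Category) := {
  cd_left_additive :> CartesianLeftAdditive C;
  cd_D : forall A B : C, hom A B -> hom (prd cd_left_additive A A) B;
  cd_combinator : is_differential_combinator cd_D
}.

(* Main.v *)
(** An S-derivation out of a free algebra is determined by its values on the
    generators, so a map of free derivations from [phi] to [psi] is a pair of
    maps [A0 -> S B0] and [A1 -> S B0 ⊗ B1]. In the opposite category, the
    derivative of such a pair at a point [a] in a direction [b] is obtained by
    composing its first component with the S-derivation over [a] taking the
    values of [b] on generators, and its second one with the extension of this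
    derivation to one-forms. The chain rule [D.4] and the product rule [D.2]
    give the axioms of a cartesian differential category on generators; the
    interchange rule [D.5] gives the symmetry of second derivatives and the
    compatibility of the derivative with [phi] and [psi].

    An object of [S_DER_free] is only known to have some presentation [phi], and
    the one chosen for a sum of presentations need not be that sum. The two are
    isomorphic, possibly by a nonlinear map, but in a cartesian differential
    category the derivative at [0] of an isomorphism is a linear isomorphism;
    hence the structure transports. *)

From Stdlib Require Import ProofIrrelevance IndefiniteDescription.
From mathcomp Require Import ssreflect ssrfun ssrbool.
Require Import Defs.

Set Implicit Arguments.
Unset Strict Implicit.
Unset Printing Implicit Defensive.

Local Open Scope cat_scope.

(** * Linear maps and transport of structure *)

Section LinearMaps.
Variables (D : Category) (L : CartesianDifferential D).
Local Notation "f +' g" := (ladd L f g) (at level 50, left associativity).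
Local Notation "0'" := (lzero L).
Local Notation "⟨ f , g ⟩" := (pair L f g).
Local Notation π1 := (pr1 L).
Local Notation π2 := (pr2 L).
Local Notation d f := (cd_D L f).
Local Notation axioms := (cd_combinator L).

Lemma pair_ext (X A B : D) (f g : hom X (prd L A B)) :
  π1 ∘ f = π1 ∘ g -> π2 ∘ f = π2 ∘ g -> f = g.
Proof. by move=> e1 e2; rewrite (pair_unique f) e1 e2 -pair_unique. Qed.

Lemma pair_comp (X Y A B : D) (f : hom Y A) (g : hom Y B) (h : hom X Y) :
  ⟨f, g⟩ ∘ h = ⟨f ∘ h, g ∘ h⟩.
Proof.
by apply: pair_ext; rewrite comp_assoc ?pr1_pair ?pr2_pair.
Qed.

(** Linearity in the differential sense; by [linear_add] it implies additivity. *)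
Definition linear (A B : D) (f : hom A B) : Prop := d f = f ∘ π2.

(** For linear [l], [l ∘ h] is the derivative of [l] in the direction [h] at any point, here [f], so
    additivity in the direction applies. *)
Lemma linear_add (X A B : D) (l : hom A B) (f g : hom X A) :
  linear l -> l ∘ (f +' g) = l ∘ f +' l ∘ g.
Proof.
move=> lP; have lE h : l ∘ h = d l ∘ ⟨f, h⟩ by rewrite lP -comp_assoc pr2_pair.
by rewrite !lE (cd_add_dir axioms).
Qed.

Lemma linear_zero (X A B : D) (l : hom A B) :
  linear l -> l ∘ (0' : hom X A) = 0'.
Proof.
move=> lP; have lE h : l ∘ h = d l ∘ ⟨h, h⟩ by rewrite lP -comp_assoc pr2_pair.
by rewrite lE (cd_zero_dir axioms).
Qed.

Lemma d_linear_comp (X A B : D) (l : hom A B) (f : hom X A) :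
  linear l -> d (l ∘ f) = l ∘ d f.
Proof. by move=> lP; rewrite (cd_comp axioms) lP -comp_assoc pr2_pair. Qed.

Lemma d_comp_linear (X A B : D) (f : hom A B) (l : hom X A) :
  linear l -> d (f ∘ l) = d f ∘ ⟨l ∘ π1, l ∘ π2⟩.
Proof. by move=> lP; rewrite (cd_comp axioms) lP. Qed.

Lemma linear_inverse (A B : D) (l : hom A B) (l' : hom B A) :
  linear l -> l ∘ l' = 1_(B) -> l' ∘ l = 1_(A) -> linear l'.
Proof.
move=> lP ll' l'l; rewrite /linear -(comp_idl (d l')) -l'l -comp_assoc.
by rewrite -d_linear_comp // ll' (cd_id axioms).
Qed.

Definition linearize (A B : D) (f : hom A B) : hom A B := d f ∘ ⟨0', 1_(A)⟩.

(** The chain rule gives the second derivative of [f] at [⟨⟨0', π1⟩, ⟨0', π2⟩⟩], where [cd_linear]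
    applies. *)
Lemma linear_linearize (A B : D) (f : hom A B) : linear (linearize f).
Proof.
rewrite /linear /linearize (cd_comp axioms) (cd_pair axioms) (cd_zero axioms).
rewrite (cd_id axioms) pair_comp comp_idl lzero_comp.
have -> : (0' : hom (prd L A A) A) = 0' ∘ π2 by rewrite lzero_comp.
rewrite lzero_comp (cd_linear axioms) -comp_assoc pair_comp comp_idl.
by rewrite lzero_comp.
Qed.

(** The inverse of [linearize f], when [g] is the inverse of [f]: the
    derivative of [g] at the point [f 0]. *)
Definition linearize_inv (A B : D) (f : hom A B) (g : hom B A) : hom B A :=
  d g ∘ ⟨f ∘ 0', 1_(B)⟩.

(** Chain rule for [f ∘ g] at the point [f 0], which [g] sends back to [0]. *)
Lemma linearizeK (A B : D) (f : hom A B) (g : hom B A) :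
  f ∘ g = 1_(B) -> g ∘ f = 1_(A) -> linearize f ∘ linearize_inv f g = 1_(B).
Proof.
move=> fg gf; rewrite /linearize /linearize_inv.
have -> : d f ∘ ⟨0', 1_(A)⟩ ∘ (d g ∘ ⟨f ∘ 0', 1_(B)⟩)
    = d (f ∘ g) ∘ ⟨f ∘ 0', 1_(B)⟩.
  rewrite (cd_comp axioms) -!comp_assoc !pair_comp comp_idl lzero_comp.
  by rewrite -(comp_assoc g) pr1_pair comp_assoc gf comp_idl.
by rewrite fg (cd_id axioms) pr2_pair.
Qed.

Lemma linearize_invK (A B : D) (f : hom A B) (g : hom B A) :
  g ∘ f = 1_(A) -> linearize_inv f g ∘ linearize f = 1_(A).
Proof.
move=> gf; rewrite /linearize /linearize_inv.
have -> : d g ∘ ⟨f ∘ 0', 1_(B)⟩ ∘ (d f ∘ ⟨0', 1_(A)⟩)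
    = d (g ∘ f) ∘ ⟨0', 1_(A)⟩.
  rewrite (cd_comp axioms) -!comp_assoc !pair_comp comp_idl.
  by rewrite -!comp_assoc pr1_pair lzero_comp.
by rewrite gf (cd_id axioms) pr2_pair.
Qed.

End LinearMaps.

(** * Transport of the structure along an equivalence with linear comparison maps *)

Section Transport.
Variables (C D : Category) (L : CartesianDifferential D).
(** [up] and [down] express that [G] is fully faithful; [F], [l] and [l'] express that it is
    essentially surjective through linear isomorphisms. *)
Variables (G : C -> D) (up : forall A B : C, hom A B -> hom (G A) (G B)).
Variable down : forall A B : C, hom (G A) (G B) -> hom A B.
Arguments up {A B}.
Arguments down {A B}.
Hypothesis upK : forall (A B : C) (f : hom A B), down (up f) = f.
Hypothesis downK : forall (A B : C) (g : hom (G A) (G B)), up (down g) = g.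
Hypothesis up_id : forall A : C, up 1_(A) = 1_(G A).
Hypothesis up_comp : forall (A B E : C) (g : hom B E) (f : hom A B),
  up (g ∘ f) = up g ∘ up f.
Variables (F : D -> C) (l : forall A : D, hom (G (F A)) A).
Variable l' : forall A : D, hom A (G (F A)).
Hypothesis lP : forall A, linear L (l A).
Hypothesis lK : forall A, l A ∘ l' A = 1_(A).
Hypothesis l'K : forall A, l' A ∘ l A = 1_(G (F A)).

Local Notation "f +' g" := (ladd L f g) (at level 50, left associativity).
Local Notation "0'" := (lzero L).
Local Notation "⟨ f , g ⟩" := (pair L f g).
Local Notation π1 := (pr1 L).
Local Notation π2 := (pr2 L).
Local Notation d f := (cd_D L f).
Local Notation axioms := (cd_combinator L).

Let l'P A : linear L (l' A).
Proof. exact: linear_inverse (lP A) (lK A) (l'K A). Qed.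

Let up_inj (A B : C) (f g : hom A B) : up f = up g -> f = g.
Proof. by move=> fg; rewrite -(upK f) fg upK. Qed.

Let l_cancel (A B : D) (f : hom A B) (X : D) (g : hom X A) :
  f ∘ l A ∘ (l' A ∘ g) = f ∘ g.
Proof. by rewrite comp_assoc -(comp_assoc f) lK comp_idr. Qed.

Definition transport_products : FiniteProducts C.
Proof.
refine (@Build_FiniteProducts C (F (term L))
  (fun A => down (l' _ ∘ bang L (G A))) _
  (fun A B => F (prd L (G A) (G B)))
  (fun A B => down (π1 ∘ l _)) (fun A B => down (π2 ∘ l _))
  (fun X A B f g => down (l' _ ∘ ⟨up f, up g⟩)) _ _ _).
- move=> A f; apply: up_inj; rewrite downK -(bang_unique (l _ ∘ up f)).
  by rewrite comp_assoc l'K comp_idl.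
- by move=> X A B f g; apply: up_inj; rewrite up_comp !downK l_cancel pr1_pair.
- by move=> X A B f g; apply: up_inj; rewrite up_comp !downK l_cancel pr2_pair.
- move=> X A B h; apply: up_inj; rewrite !(up_comp, downK).
  by rewrite -!comp_assoc -pair_unique comp_assoc l'K comp_idl.
Defined.

(** The transported projections are [π1 ∘ l] and [π2 ∘ l]; they preserve sums because [l] is
    linear. *)
Definition transport_left_additive : CartesianLeftAdditive C.
Proof.
refine (@Build_CartesianLeftAdditive C transport_products
  (fun A B f g => down (up f +' up g)) (fun A B => down 0') _ _ _ _ _ _ _ _ _).
- by move=> A B f g h; rewrite !downK laddA.
- by move=> A B f g; rewrite laddC.
- by move=> A B f; rewrite downK ladd0 upK.
- by move=> A B E f g h; apply: up_inj; rewrite !(up_comp, downK) ladd_comp.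
- by move=> A B E h; apply: up_inj; rewrite up_comp !downK lzero_comp.
- move=> X A B f g; apply: up_inj; rewrite /= !(up_comp, downK).
  by rewrite -!comp_assoc linear_add // pr1_ladd.
- move=> X A B f g; apply: up_inj; rewrite /= !(up_comp, downK).
  by rewrite -!comp_assoc linear_add // pr2_ladd.
- move=> X A B; apply: up_inj; rewrite /= !(up_comp, downK).
  by rewrite -!comp_assoc linear_zero // pr1_lzero.
- move=> X A B; apply: up_inj; rewrite /= !(up_comp, downK).
  by rewrite -!comp_assoc linear_zero // pr2_lzero.
Defined.

Lemma transport_combinator :
  is_differential_combinator (L := transport_left_additive)
    (fun A B f => down (d (up f) ∘ l _)).
Proof.
(* A linear [l] acts on point and direction alike, so in a second derivative it cancels against both
   copies of [l']. *)
have dd_l (X A B : C) (f : hom A B) (g h : hom (G X) (prd L (G A) (G A))) :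
    d (d (up f) ∘ l (prd L (G A) (G A))) ∘ ⟨l' _ ∘ g, l' _ ∘ h⟩
    = d (d (up f)) ∘ ⟨g, h⟩.
  rewrite d_comp_linear // -comp_assoc pair_comp -!comp_assoc.
  by rewrite pr1_pair pr2_pair !(comp_assoc (l _)) lK !comp_idl.
split=> [A B f g|A B|X A B f a b b'|X A B f a|A|A B|A B|X A B f g|A B E g f
  |X A B f a b e|X A B f a b e h]; apply: up_inj;
  rewrite /= !(up_comp, downK, up_id, l_cancel).
- by rewrite (cd_add axioms) ladd_comp.
- by rewrite (cd_zero axioms) lzero_comp.
- exact: (cd_add_dir axioms).
- exact: (cd_zero_dir axioms).
- by rewrite (cd_id axioms).
- by rewrite (d_linear_comp _ (cd_pr1 axioms _ _)) lP -!comp_assoc.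
- by rewrite (d_linear_comp _ (cd_pr2 axioms _ _)) lP -!comp_assoc.
- by rewrite d_linear_comp // (cd_pair axioms) -comp_assoc pair_comp.
- by rewrite (cd_comp axioms) -comp_assoc pair_comp -comp_assoc.
- by rewrite dd_l (cd_linear axioms).
- by rewrite !dd_l (cd_symmetric axioms).
Qed.

Definition transport_cartesian_differential : CartesianDifferential C :=
  Build_CartesianDifferential transport_combinator.

End Transport.

(** * Change of objects along equalities, and categories induced by a map of objects *)

Definition cast (C : Category) (A B : C) (e : A = B) : hom A B :=
  eq_rect A (hom A) 1_(A) B e.

Lemma castK (C : Category) (A B : C) (e : A = B) :
  cast (esym e) ∘ cast e = 1_(A).
Proof. by case: B / e => /=; apply: comp_idl. Qed.

Lemma cast_symK (C : Category) (A B : C) (e : A = B) :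
  cast e ∘ cast (esym e) = 1_(B).
Proof. by case: B / e => /=; apply: comp_idl. Qed.

Definition recast (C : Category) (A A' B B' : C) (eA : A = A') (eB : B = B')
    (f : hom A B) : hom A' B' := cast eB ∘ f ∘ cast (esym eA).

Lemma recastK (C : Category) (A A' B B' : C) (eA : A = A') (eB : B = B')
    (f : hom A B) : recast (esym eA) (esym eB) (recast eA eB f) = f.
Proof.
by case: A' / eA; case: B' / eB; rewrite /recast /= !comp_idl !comp_idr.
Qed.

Lemma recast_symK (C : Category) (A A' B B' : C) (eA : A = A') (eB : B = B')
    (f : hom A' B') : recast eA eB (recast (esym eA) (esym eB) f) = f.
Proof.
by move: f; case: A' / eA; case: B' / eB => f;
  rewrite /recast /= !comp_idl !comp_idr.
Qed.

Lemma recast_id (C : Category) (A A' : C) (eA : A = A') :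
  recast eA eA 1_(A) = 1_(A').
Proof. by case: A' / eA; rewrite /recast /= !comp_idl. Qed.

Lemma recast_comp (C : Category) (A A' B B' D D' : C) (eA : A = A')
    (eB : B = B') (eD : D = D') (g : hom B D) (f : hom A B) :
  recast eA eD (g ∘ f) = recast eB eD g ∘ recast eA eB f.
Proof.
by case: A' / eA; case: B' / eB; case: D' / eD;
  rewrite /recast /= !comp_idl !comp_idr.
Qed.

Definition induced_category (C : Category) (T : Type) (F : T -> C) : Category :=
{|
  ob := T;
  hom := fun s t => hom (F s) (F t);
  idm := fun t => 1_(F t);
  comp := fun r s t q p => q ∘ p;
  comp_idl := fun s t p => comp_idl p;
  comp_idr := fun s t p => comp_idr p;
  comp_assoc := fun q r s t h g f => comp_assoc h g f |}.

Lemma cartesian_differential_surj (C : Category) (T : Type) (F : T -> C) :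
  (forall A, exists t, F t = A) ->
  CartesianDifferential (opposite (induced_category F)) ->
  inhabited (CartesianDifferential (opposite C)).
Proof.
move=> F_surj L.
have [G e] := functional_choice (fun A t => F t = A) F_surj.
(* [t] and [G (F t)] have the same image, so they are isomorphic, but [k t] may fail to be linear
   for [L]; its derivative at [0] replaces it. *)
pose k t : hom (F t) (F (G (F t))) := cast (esym (e (F t))).
pose k' t : hom (F (G (F t))) (F t) := cast (e (F t)).
constructor.
refine (@transport_cartesian_differential (opposite C) _ L G
  (fun A B f => recast (esym (e B)) (esym (e A)) f)
  (fun A B g => recast (e B) (e A) g) _ _ _ _ F
  (fun t => linearize L (k t)) (fun t => linearize_inv L (k t) (k' t)) _ _ _).
- move=> A B f; exact: (recast_symK (e B) (e A)).
- move=> A B g; exact: (recastK (e B) (e A)).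
- move=> A; exact: (recast_id (esym (e A))).
- move=> A B D g f.
  exact: (recast_comp (esym (e D)) (esym (e B)) (esym (e A)) f g).
- by move=> t; apply: linear_linearize.
- by move=> t; apply: linearizeK;
    [exact: (cast_symK (e (F t))) | exact: (castK (e (F t)))].
- by move=> t; apply: linearize_invK; exact: (castK (e (F t))).
Qed.

(** * Symmetric monoidal coherence and modules *)

Section Coherence.
Context {X : Category} {monX : SymmetricMonoidal X}.

Lemma comp_eqr (A B C D : X) (g : hom B C) (f : hom A B) (k : hom A C)
    (h : hom C D) : g ∘ f = k -> h ∘ g ∘ f = h ∘ k.
Proof. by move=> <-; rewrite comp_assoc. Qed.

Lemma tensm_compl (A B D A' B' : X) (g : hom B D) (f : hom A B)
    (h : hom A' B') : (g ∘ f) ⊗ h = (g ⊗ h) ∘ (f ⊗ 1_(A')).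
Proof. by rewrite -tensm_comp comp_idr. Qed.

Lemma tensm_compr (A B A' B' D' : X) (h : hom A B) (g : hom B' D')
    (f : hom A' B') : h ⊗ (g ∘ f) = (h ⊗ g) ∘ (1_(A) ⊗ f).
Proof. by rewrite -tensm_comp comp_idr. Qed.

Lemma tensm_split (A A' B B' : X) (f : hom A A') (g : hom B B') :
  f ⊗ g = (f ⊗ 1_(B')) ∘ (1_(A) ⊗ g).
Proof. by rewrite -tensm_comp comp_idl comp_idr. Qed.

Lemma split_epi_cancel (A B D : X) (e : hom A B) (s : hom B A)
    (f g : hom B D) : e ∘ s = 1_(B) -> f ∘ e = g ∘ e -> f = g.
Proof.
by move=> es fg; rewrite -(comp_idr f) -(comp_idr g) -es !comp_assoc fg.
Qed.

Lemma split_mono_cancel (A B D : X) (e : hom B D) (s : hom D B)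
    (f g : hom A B) : s ∘ e = 1_(B) -> e ∘ f = e ∘ g -> f = g.
Proof.
by move=> es fg; rewrite -(comp_idl f) -(comp_idl g) -es -!comp_assoc fg.
Qed.

Lemma comp_split_epi (A B D : X) (e : hom B D) (s : hom D B) (e' : hom A B)
    (s' : hom B A) :
  e ∘ s = 1_(D) -> e' ∘ s' = 1_(B) -> (e ∘ e') ∘ (s' ∘ s) = 1_(D).
Proof. by move=> es es'; rewrite comp_assoc (comp_eqr _ es') comp_idr. Qed.

Lemma tensm_split_epi (A B A' B' : X) (e : hom A B) (s : hom B A)
    (e' : hom A' B') (s' : hom B' A') :
  e ∘ s = 1_(B) -> e' ∘ s' = 1_(B') -> (e ⊗ e') ∘ (s ⊗ s') = 1_(B ⊠ B').
Proof. by move=> es es'; rewrite -tensm_comp es es' tensm_id. Qed.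

Lemma assoc_inv_natural (A B D A' B' D' : X) (f : hom A A') (g : hom B B')
    (h : hom D D') :
  assoc_inv A' B' D' ∘ (f ⊗ (g ⊗ h)) = ((f ⊗ g) ⊗ h) ∘ assoc_inv A B D.
Proof.
apply: (split_mono_cancel (assocK A' B' D')).
apply: (split_epi_cancel (assoc_invK A B D)).
rewrite !comp_assoc assoc_invK comp_idl -assoc_natural.
by rewrite -(comp_assoc _ (assoc_inv _ _ _)) assocK comp_idr.
Qed.

Lemma lunit_inv_natural (A B : X) (f : hom A B) :
  lunit_inv B ∘ f = (1_(unitI) ⊗ f) ∘ lunit_inv A.
Proof.
apply: (split_mono_cancel (lunitK B)).
by rewrite !comp_assoc lunit_invK lunit_natural comp_idl -comp_assoc
  lunit_invK comp_idr.
Qed.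

Lemma unit_tensor_faithful (A B : X) (f g : hom A B) :
  1_(unitI) ⊗ f = 1_(unitI) ⊗ g -> f = g.
Proof.
by move=> fg; apply: (split_epi_cancel (lunit_invK A));
  rewrite -!lunit_natural fg.
Qed.

(** Kelly's derivation of the second triangle: compare after tensoring with
    the unit and cancelling associators. *)
Lemma lunit_tensor (A B : X) :
  lunit (A ⊠ B) ∘ assoc unitI A B = lunit A ⊗ 1_(B).
Proof.
apply: unit_tensor_faithful; rewrite tensm_compr.
pose proof (comp_split_epi (assoc_invK unitI (unitI ⊠ A) B)
  (tensm_split_epi (assoc_invK unitI unitI A) (comp_idl 1_(B)))) as epi.
apply: (split_epi_cancel epi).
rewrite !comp_assoc -assoc_natural.
rewrite -(comp_assoc (assoc _ _ _)) -(tensm_comp (1_(_) ⊗ lunit A)).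
rewrite triangle comp_idl assoc_natural tensm_id -triangle.
by rewrite -!comp_assoc pentagon !comp_assoc.
Qed.

Lemma pentagon_inv (A B D E : X) :
  assoc_inv A (B ⊠ D) E ∘ (1_(A) ⊗ assoc_inv B D E) ∘ assoc A B (D ⊠ E)
  = (assoc A B D ⊗ 1_(E)) ∘ assoc_inv (A ⊠ B) D E.
Proof.
apply: (split_epi_cancel (assoc_invK (A ⊠ B) D E)).
rewrite -(comp_assoc _ (assoc_inv _ _ _)) assocK comp_idr.
rewrite -comp_assoc pentagon !comp_assoc -(comp_assoc _ (_ ⊗ _) (_ ⊗ _)).
by rewrite -tensm_comp assocK comp_idl tensm_id comp_idr assocK comp_idl.
Qed.

(** The hexagon for [sym Q (P ⊠ R)], inverted: both sides are right inverses of that symmetry, which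
    is a split monomorphism. *)
Lemma sym_tensor (P R Q : X) :
  assoc Q P R ∘ (sym P Q ⊗ 1_(R)) ∘ assoc_inv P Q R
    ∘ (1_(P) ⊗ sym R Q) ∘ assoc P R Q
  = sym (P ⊠ R) Q.
Proof.
pose proof (comp_split_epi
  (comp_split_epi (tensm_split_epi (comp_idl 1_(P)) (symK R Q))
     (assoc_invK P Q R))
  (tensm_split_epi (symK P Q) (comp_idl 1_(R)))) as inv.
rewrite -hexagon in inv.
apply: (split_mono_cancel (symK Q (P ⊠ R))); rewrite symK.
apply: (split_mono_cancel (assocK P R Q)).
by rewrite !comp_assoc in inv *; rewrite inv comp_idl comp_idr.
Qed.

End Coherence.

Section Modules.
Context {X : Category} {monX : SymmetricMonoidal X}.
Variables (N : X) (m : hom (N ⊠ N) N) (u : hom unitI N).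
Hypothesis monN : is_commutative_monoid m u.

Lemma regular_module : is_module m u m.
Proof. by case: monN => mA mul _ _; split; [apply: esym|]. Qed.

Definition free_act (B : X) : hom (N ⊠ (N ⊠ B)) (N ⊠ B) :=
  (m ⊗ 1_(B)) ∘ assoc_inv N N B.

Lemma free_module (B : X) : is_module m u (free_act B).
Proof.
case: monN => mA mul _ _; split; rewrite /free_act.
- rewrite tensm_compr !comp_assoc (comp_eqr _ (assoc_inv_natural _ _ _)).
  rewrite comp_assoc -tensm_compl -!comp_assoc (comp_assoc (assoc_inv _ _ _)).
  rewrite pentagon_inv !comp_assoc -tensm_compl -mA tensm_compl.
  by rewrite -!comp_assoc -assoc_inv_natural tensm_id.
- rewrite -tensm_id -comp_assoc assoc_inv_natural comp_assoc -tensm_compl mul.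
  by rewrite -lunit_tensor -comp_assoc assoc_invK comp_idr.
Qed.

(** Makes a module map out of [N ⊠ B] determined by its restriction to [B]. *)
Lemma free_act_unit (B : X) :
  free_act B ∘ (1_(N) ⊗ ((u ⊗ 1_(B)) ∘ lunit_inv B)) = 1_(N ⊠ B).
Proof.
case: monN => _ _ mur _; rewrite /free_act tensm_compr comp_assoc.
rewrite (comp_eqr _ (assoc_inv_natural _ _ _)) comp_assoc -tensm_compl mur.
rewrite -triangle (comp_eqr _ (assoc_invK _ _ _)) comp_idr.
by rewrite -tensm_compr lunit_invK tensm_id.
Qed.

Variables (M : X) (act : hom (N ⊠ M) M).
Hypothesis modM : is_module m u act.

(** The module law on generalized elements: [(x y) v = x (y v)]. *)
Lemma act_assoc (P Q R : X) (x : hom P N) (y : hom Q N) (v : hom R M) :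
  act ∘ ((m ∘ (x ⊗ y)) ⊗ v) = act ∘ (x ⊗ (act ∘ (y ⊗ v))) ∘ assoc P Q R.
Proof.
rewrite (tensm_split (m ∘ _)) (tensm_compl m) !comp_assoc -(mod_assoc modM).
rewrite -!comp_assoc -(tensm_comp (x ⊗ y)).
rewrite comp_idl comp_idr assoc_natural.
by rewrite (comp_assoc (1_(N) ⊗ act)) -(tensm_comp 1_(N)) comp_idl.
Qed.

Lemma act_unit (P : X) (v : hom P M) : act ∘ (u ⊗ v) ∘ lunit_inv P = v.
Proof.
rewrite (tensm_split u) comp_assoc (mod_unit modM) lunit_natural -comp_assoc.
by rewrite lunit_invK comp_idr.
Qed.

(** [y (x v) = x (y v)]: both are [(x y) v], by commutativity of [m]. *)
Lemma act_swap (P Q R : X) (x : hom P N) (y : hom Q N) (v : hom R M) :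
  act ∘ (y ⊗ (act ∘ (x ⊗ v))) ∘ sym (P ⊠ R) Q
  = act ∘ (x ⊗ (act ∘ (y ⊗ v))) ∘ (1_(P) ⊗ sym R Q) ∘ assoc P R Q.
Proof.
have [_ _ _ mC] := monN.
rewrite -sym_tensor !comp_assoc -act_assoc.
rewrite -(comp_assoc _ (_ ⊗ v) (_ ⊗ _)) -tensm_comp comp_idr.
rewrite -(comp_assoc m) -sym_natural comp_assoc mC act_assoc.
by rewrite (comp_eqr _ (assoc_invK P Q R)) comp_idr.
Qed.

End Modules.

(** * Derivations of free algebras *)

Section FreeAlgebras.
Context {X : Category} {addX : Additive X} {monX : SymmetricMonoidal X}.
Context {asmX : AdditiveSymmetricMonoidal addX monX}.
Variable S : DifferentialModality X.

Definition alg_morphism (B Z : X) (f : hom (S B) (S Z)) : Prop :=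
  f ∘ mu S B = mu S Z ∘ fmap S f.

Definition extend (B Z : X) (k : hom B (S Z)) : hom (S B) (S Z) :=
  mu S Z ∘ fmap S k.

Lemma extend_eta (B Z : X) (k : hom B (S Z)) : extend k ∘ eta S B = k.
Proof.
by rewrite /extend -comp_assoc -eta_natural comp_assoc mu_eta comp_idl.
Qed.

Lemma extend_alg_morphism (B Z : X) (k : hom B (S Z)) :
  alg_morphism (extend k).
Proof.
rewrite /alg_morphism /extend fmap_comp -comp_assoc -mu_natural !comp_assoc.
by rewrite mu_assoc.
Qed.

Lemma alg_morphism_extend (B Z : X) (f : hom (S B) (S Z)) :
  alg_morphism f -> f = extend (f ∘ eta S B).
Proof.
by move=> fP; rewrite /extend fmap_comp comp_assoc -fP -comp_assoc mu_fmap_eta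
  comp_idr.
Qed.

Lemma alg_morphism_id (B : X) : alg_morphism 1_(S B).
Proof. by rewrite /alg_morphism comp_idl fmap_id comp_idr. Qed.

Lemma alg_morphism_comp (A B Z : X) (g : hom (S B) (S Z))
    (f : hom (S A) (S B)) :
  alg_morphism g -> alg_morphism f -> alg_morphism (g ∘ f).
Proof.
by move=> gP fP; rewrite /alg_morphism fmap_comp -comp_assoc fP !comp_assoc gP.
Qed.

(** [f] is a Kleisli extension, and both of its factors [mu] and [fmap] are multiplicative. *)
Lemma alg_morphism_mul (B Z : X) (f : hom (S B) (S Z)) :
  alg_morphism f -> f ∘ mm S B = mm S Z ∘ (f ⊗ f).
Proof.
move/alg_morphism_extend => ->; rewrite /extend; set k := f ∘ _.
rewrite tensm_comp -comp_assoc -mm_natural !comp_assoc.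
by rewrite (monm_mul (am_mu_morphism S Z)).
Qed.

Lemma alg_morphism_unit (B Z : X) (f : hom (S B) (S Z)) :
  alg_morphism f -> f ∘ uu S B = uu S Z.
Proof.
move/alg_morphism_extend => ->; rewrite /extend -comp_assoc uu_natural.
by rewrite (monm_unit (am_mu_morphism S Z)).
Qed.

Section Derive.
Variables (Z M : X) (act : hom (S Z ⊠ M) M).
Hypothesis modM : is_module (mm S Z) (uu S Z) act.

(** The S-derivation over [a] with value [v] on generators. *)
Definition derive (B : X) (a : hom (S B) (S Z)) (v : hom B M) : hom (S B) M :=
  act ∘ (a ⊗ v) ∘ dd S B.

Lemma derive_eta (B : X) (a : hom (S B) (S Z)) (v : hom B M) :
  alg_morphism a -> derive a v ∘ eta S B = v.
Proof.
move=> aP; rewrite /derive -comp_assoc dd_linear !comp_assoc.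
rewrite -(comp_assoc act) -tensm_comp comp_idr alg_morphism_unit //.
exact: (act_unit modM).
Qed.

(** By [dd_chain], [derive a v] is an S-derivation into [M] viewed as an [S B]-module along [a]. *)
Lemma derive_mu (B : X) (a : hom (S B) (S Z)) (v : hom B M) :
  alg_morphism a ->
  derive a v ∘ mu S B = act ∘ ((a ∘ mu S B) ⊗ derive a v) ∘ dd S (S B).
Proof.
move=> aP; rewrite {1}/derive -comp_assoc dd_chain !comp_assoc.
rewrite -(comp_assoc act) -tensm_comp comp_idr alg_morphism_mul //.
rewrite (act_assoc modM) (comp_eqr _ (assoc_invK _ _ _)) comp_idr.
by rewrite -(comp_assoc act) -tensm_comp.
Qed.

(** Uniqueness of S-derivations: precompose with [fmap S (eta S B)], a section of [mu], and carry it
    through [dd] by naturality. *)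
Lemma derivation_ext (B : X) (a : hom (S B) (S Z)) (D : hom (S B) M) :
  D ∘ mu S B = act ∘ ((a ∘ mu S B) ⊗ D) ∘ dd S (S B) ->
  D = derive a (D ∘ eta S B).
Proof.
move=> DP; rewrite -{1}(comp_idr D) -mu_fmap_eta comp_assoc DP.
rewrite -comp_assoc dd_natural comp_assoc -(comp_assoc act) -tensm_comp.
by rewrite -(comp_assoc a) mu_fmap_eta comp_idr.
Qed.

(** An S-derivation precomposed with an algebra morphism is an S-derivation over the composite, so
    uniqueness applies. *)
Lemma derive_comp (B Y : X) (b : hom (S Y) (S Z)) (v : hom Y M)
    (a : hom (S B) (S Y)) :
  alg_morphism b -> alg_morphism a ->
  derive b v ∘ a = derive (b ∘ a) (derive b v ∘ a ∘ eta S B).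
Proof.
move=> bP aP; apply: derivation_ext.
rewrite -comp_assoc aP comp_assoc derive_mu // -comp_assoc dd_natural comp_assoc.
by rewrite -(comp_assoc act) -tensm_comp -!comp_assoc aP.
Qed.

Lemma derive_mul (B : X) (a : hom (S B) (S Z)) (v : hom B M) (P Q : X)
    (x : hom P (S B)) (y : hom Q (S B)) :
  alg_morphism a ->
  derive a v ∘ (mm S B ∘ (x ⊗ y))
  = act ∘ ((a ∘ x) ⊗ (derive a v ∘ y))
    + act ∘ ((a ∘ y) ⊗ (derive a v ∘ x)) ∘ sym P Q.
Proof.
move=> aP.
have mulP : derive a v ∘ mm S B
    = act ∘ (a ⊗ derive a v) + act ∘ (a ⊗ derive a v) ∘ sym (S B) (S B).
  rewrite {1}/derive -comp_assoc dd_product !comp_assoc.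
  rewrite -(comp_assoc act) -tensm_comp comp_idr alg_morphism_mul //.
  rewrite (act_assoc modM) (comp_eqr _ (assoc_invK _ _ _)) comp_idr comp_addr.
  rewrite -(comp_assoc act) -tensm_comp comp_idr.
  congr (_ + _).
  (* The Leibniz term that differentiates the left factor is reordered by commutativity of [S Z]. *)
  rewrite !comp_assoc -(act_swap (am_cmonoid S Z) modM).
  by rewrite -comp_assoc sym_natural comp_assoc -(comp_assoc act) -tensm_comp
    comp_idr.
rewrite comp_assoc mulP comp_addl (comp_eqr _ (sym_natural _ _)) comp_assoc.
by rewrite -!(comp_assoc act (a ⊗ _)) -!tensm_comp.
Qed.

End Derive.

(** In polynomial terms both sides are the sum of the second partial derivatives [∂i ∂j], evaluated
    at [a], times [q_i v_j]; [dd_interchange] exchanges the order of the two derivatives. *)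
Lemma derive_interchange (Z M : X) (act : hom (S Z ⊠ M) M) (B : X)
    (a : hom (S B) (S Z)) (q : hom B (S Z)) (v : hom B M) :
  is_module (mm S Z) (uu S Z) act -> alg_morphism a ->
  act ∘ (q ⊗ derive act a v) ∘ sym (S B) B ∘ dd S B
  = act ∘ (derive (mm S Z) a q ⊗ v) ∘ dd S B.
Proof.
move=> modM aP; rewrite /derive tensm_compr comp_assoc.
rewrite -(comp_assoc _ (_ ⊗ _)) -sym_natural comp_assoc.
rewrite (act_swap (am_cmonoid S Z) modM) -!comp_assoc.
rewrite (comp_assoc (assoc _ _ _)) (comp_assoc (_ ⊗ sym _ _)).
rewrite (comp_assoc (_ ⊗ sym _ _)) dd_interchange !comp_assoc.
rewrite -(act_assoc modM).
by rewrite -(comp_assoc act) -tensm_comp comp_idr.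
Qed.

Lemma derive_mul_sym (Z B : X) (a : hom (S B) (S Z)) (q r : hom B (S Z)) :
  alg_morphism a ->
  mm S Z ∘ (derive (mm S Z) a q ⊗ r) ∘ dd S B
  = mm S Z ∘ (derive (mm S Z) a r ⊗ q) ∘ dd S B.
Proof.
move=> aP; have mS := am_cmonoid S Z.
rewrite -(derive_interchange q r (regular_module mS) aP).
rewrite -(comp_assoc (mm S Z)) -sym_natural comp_assoc.
by rewrite (cmon_comm mS).
Qed.

(** Leibniz rule on [mm ∘ (a ⊗ w) ∘ dd]: the first summand differentiates [w], the second the factor
    [a]. The latter is of second order and is reordered by [derive_interchange]. *)
Lemma derive_derive (Z M : X) (act : hom (S Z ⊠ M) M) (B Y : X)
    (b : hom (S Y) (S Z)) (v : hom Y M) (a : hom (S B) (S Y))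
    (w : hom B (S Y)) :
  is_module (mm S Z) (uu S Z) act -> alg_morphism b -> alg_morphism a ->
  derive act b v ∘ derive (mm S Y) a w
  = derive act (b ∘ a) (derive act b v ∘ w)
    + act ∘ (derive (mm S Z) (b ∘ a) (b ∘ w)
             ⊗ (derive act b v ∘ a ∘ eta S B)) ∘ dd S B.
Proof.
move=> modM bP aP; rewrite {2}/derive comp_assoc derive_mul // comp_addl.
have baP := alg_morphism_comp bP aP.
by rewrite (derive_comp modM v bP aP) derive_interchange // derive_eta.
Qed.

End FreeAlgebras.

(** * Free derivations *)

Section FreeDerivations.
Context {X : Category} {addX : Additive X} {monX : SymmetricMonoidal X}.
Context {asmX : AdditiveSymmetricMonoidal addX monX}.
Variable S : DifferentialModality X.

Lemma maddACA (A B : X) (f g h k : hom A B) :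
  (f + g) + (h + k) = (f + h) + (g + k).
Proof. by rewrite -!maddA (maddA g) (maddC g) -(maddA h). Qed.

Lemma maddr0 (A B : X) (f : hom A B) : f + 0 = f.
Proof. by rewrite maddC madd0. Qed.

(** * Presentations and their free derivations *)

Record presentation := {
  base : X;
  coeff : X;
  form : hom base coeff
}.

Local Notation act t := (free_act (mm S (base t)) (coeff t)).
Local Notation modP t := (free_module (am_cmonoid S (base t)) (coeff t)).
Local Notation regP t := (regular_module (am_cmonoid S (base t))).

Definition gen_incl (A B : X) : hom B (S A ⊠ B) :=
  (uu S A ⊗ 1_(B)) ∘ lunit_inv B.

Lemma free_act_gen_incl (A B : X) (P : X) (x : hom P (S A)) :
  free_act (mm S A) B ∘ (x ⊗ gen_incl A B) = x ⊗ 1_(B).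
Proof.
rewrite -{1}(comp_idl x) -(comp_idr (gen_incl A B)) tensm_comp comp_assoc.
by rewrite (free_act_unit (am_cmonoid S A)) comp_idl.
Qed.

Definition universal (t : presentation) :
  hom (S (base t)) (S (base t) ⊠ coeff t) := (1_(_) ⊗ form t) ∘ dd S (base t).

(** Brings the universal derivation under the calculus of [derive]. *)
Lemma universalE (t : presentation) :
  universal t = derive (act t) 1_(_) (gen_incl (base t) (coeff t) ∘ form t).
Proof.
rewrite /derive -(comp_idl 1_(S (base t))) tensm_comp comp_assoc.
by rewrite free_act_gen_incl tensm_id comp_idl.
Qed.

Lemma free_derivationP (t : presentation) :
  is_derivation (free_derivation S (form t)).
Proof.
have mulE : alg_mul (mu S (base t)) = mm S (base t).
  rewrite /alg_mul (monm_mul (am_mu_morphism S _)) -comp_assoc -tensm_comp.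
  by rewrite mu_eta tensm_id comp_idr.
have unitE : alg_unit (mu S (base t)) = uu S (base t).
  exact: monm_unit (am_mu_morphism S _).
split=> /=.
- by split; [apply: mu_eta | apply/esym/mu_assoc].
- by rewrite mulE unitE; apply: (modP t).
- have := derive_mu (modP t) (gen_incl (base t) (coeff t) ∘ form t)
    (alg_morphism_id S _).
  by rewrite -universalE comp_idl.
Qed.

Definition free_der (t : presentation) : Derivation S :=
  Build_Derivation (free_derivationP t).

(** * Morphisms of free derivations as pairs of maps on generators *)

Local Notation Hom s t := (DerivationMorphism (free_der s) (free_der t)).

Definition alg_part (s t : presentation) (p : Hom s t) :
  hom (S (base s)) (S (base t)) := dmor_alg p.

Definition mod_part (s t : presentation) (p : Hom s t) :
  hom (S (base s) ⊠ coeff s) (S (base t) ⊠ coeff t) := dmor_mod p.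

Definition gen0 (s t : presentation) (p : Hom s t) : hom (base s) (S (base t)) :=
  alg_part p ∘ eta S (base s).

Definition gen1 (s t : presentation) (p : Hom s t) :
  hom (coeff s) (S (base t) ⊠ coeff t) :=
  mod_part p ∘ gen_incl (base s) (coeff s).

Lemma alg_partP (s t : presentation) (p : Hom s t) : alg_morphism (alg_part p).
Proof. exact: dmor_nu p. Qed.

Lemma alg_partE (s t : presentation) (p : Hom s t) :
  alg_part p = extend (gen0 p).
Proof. exact/alg_morphism_extend/alg_partP. Qed.

Lemma mod_part_act (s t : presentation) (p : Hom s t) :
  mod_part p ∘ act s = act t ∘ (alg_part p ⊗ mod_part p).
Proof. exact: dmor_act p. Qed.

Lemma mod_partE (s t : presentation) (p : Hom s t) :
  mod_part p = act t ∘ (alg_part p ⊗ gen1 p).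
Proof.
rewrite /gen1 tensm_compr comp_assoc -mod_part_act -comp_assoc.
by rewrite free_act_gen_incl tensm_id comp_idr.
Qed.

(** The only constraint linking the two components: [mk_hom] shows that it suffices. *)
Lemma gen1_form (s t : presentation) (p : Hom s t) :
  gen1 p ∘ form s = universal t ∘ gen0 p.
Proof.
have pD : mod_part p ∘ universal s = universal t ∘ alg_part p := dmor_map p.
rewrite /gen0 /gen1 comp_assoc -pD -!(comp_assoc (mod_part p)) universalE.
by rewrite (derive_eta (modP s)) //; apply: alg_morphism_id.
Qed.

Lemma hom_ext (s t : presentation) (p q : Hom s t) :
  gen0 p = gen0 q -> gen1 p = gen1 q -> p = q.
Proof.
move=> e0 e1; have ea : alg_part p = alg_part q by rewrite !alg_partE e0.
by apply: dmor_eq => //; rewrite -!/(mod_part _) !mod_partE ea e1.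
Qed.

Definition mk_hom (s t : presentation) (f : hom (base s) (S (base t)))
    (g : hom (coeff s) (S (base t) ⊠ coeff t))
    (fg : g ∘ form s = universal t ∘ f) : Hom s t.
Proof.
refine (@Build_DerivationMorphism _ _ _ _ (free_der s) (free_der t)
  (extend f) (act t ∘ (extend f ⊗ g)) _ _ _).
- exact: extend_alg_morphism.
- have fP := extend_alg_morphism f.
  rewrite /= -!/(free_act _ _) {1}/free_act comp_assoc.
  rewrite -(comp_assoc (act t)) -tensm_comp comp_idr alg_morphism_mul //.
  by rewrite (act_assoc (modP t)) (comp_eqr _ (assoc_invK _ _ _)) comp_idr.
- have fP := extend_alg_morphism f.
  rewrite /= -!/(universal _) (universalE t).
  (* [universal t ∘ extend f] is an S-derivation over [extend f], so only its values on generators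
     matter, and [fg] gives them. *)
  rewrite (derive_comp (modP t) _ (alg_morphism_id S _) fP) -universalE.
  rewrite comp_idl -(comp_assoc _ _ (eta S _)) extend_eta -fg /derive.
  by rewrite /universal comp_assoc -(comp_assoc (act t)) -tensm_comp comp_idr.
Defined.

Lemma gen0_mk (s t : presentation) (f : hom (base s) (S (base t)))
    (g : hom (coeff s) (S (base t) ⊠ coeff t))
    (fg : g ∘ form s = universal t ∘ f) : gen0 (mk_hom fg) = f.
Proof. exact: extend_eta. Qed.

Lemma gen1_mk (s t : presentation) (f : hom (base s) (S (base t)))
    (g : hom (coeff s) (S (base t) ⊠ coeff t))
    (fg : g ∘ form s = universal t ∘ f) : gen1 (mk_hom fg) = g.
Proof.
rewrite /gen1 /mod_part /= /gen_incl comp_assoc -(comp_assoc (act t)).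
rewrite -tensm_comp comp_idr alg_morphism_unit; last exact: extend_alg_morphism.
exact: (act_unit (modP t)).
Qed.

Local Notation "q • p" := (dmor_comp q p) (at level 40, left associativity).

Lemma gen0_comp (r s t : presentation) (q : Hom s t) (p : Hom r s) :
  gen0 (q • p) = alg_part q ∘ gen0 p.
Proof. exact/esym/comp_assoc. Qed.

Lemma gen1_comp (r s t : presentation) (q : Hom s t) (p : Hom r s) :
  gen1 (q • p) = mod_part q ∘ gen1 p.
Proof. exact/esym/comp_assoc. Qed.

(** * Sums of morphisms, and morphisms induced by maps of [X] *)

(** Sums are taken on generators, since a sum of algebra morphisms is in general not one. *)
Definition hom_add (s t : presentation) (p q : Hom s t) : Hom s t.
Proof.
refine (@mk_hom s t (gen0 p + gen0 q) (gen1 p + gen1 q) _).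
by rewrite comp_addl comp_addr !gen1_form.
Defined.

Definition hom_zero (s t : presentation) : Hom s t.
Proof.
by refine (@mk_hom s t 0 0 _); rewrite comp_zerol comp_zeror.
Defined.

Definition lin_hom (s t : presentation) (f0 : hom (base s) (base t))
    (f1 : hom (coeff s) (coeff t)) (fP : f1 ∘ form s = form t ∘ f0) : Hom s t.
Proof.
refine (@mk_hom s t (eta S _ ∘ f0) (gen_incl _ _ ∘ f1) _).
rewrite -comp_assoc fP !comp_assoc universalE.
by rewrite (derive_eta (modP t)) //; apply: alg_morphism_id.
Defined.

Lemma gen0_comp_lin (r s t : presentation) (q : Hom s t)
    (f0 : hom (base r) (base s)) (f1 : hom (coeff r) (coeff s))
    (fP : f1 ∘ form r = form s ∘ f0) :
  gen0 (q • lin_hom fP) = gen0 q ∘ f0.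
Proof. by rewrite gen0_comp gen0_mk comp_assoc. Qed.

Lemma gen1_comp_lin (r s t : presentation) (q : Hom s t)
    (f0 : hom (base r) (base s)) (f1 : hom (coeff r) (coeff s))
    (fP : f1 ∘ form r = form s ∘ f0) :
  gen1 (q • lin_hom fP) = gen1 q ∘ f1.
Proof. by rewrite gen1_comp gen1_mk comp_assoc. Qed.

(** * The derivative at a point in a direction *)

Section Direction.
Variables (s t : presentation).
Implicit Types a b : Hom s t.

Definition dir0 a b : hom (S (base s)) (S (base t)) :=
  derive (mm S (base t)) (alg_part a) (gen0 b).

(** The analogue on one-forms of a Lie derivative: the Leibniz rule for a coefficient times a
    generator. *)
Definition dir1 a b : hom (S (base s) ⊠ coeff s) (S (base t) ⊠ coeff t) :=
  act t ∘ (dir0 a b ⊗ gen1 a) + act t ∘ (alg_part a ⊗ gen1 b).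

Lemma dir0_mul a b (P Q : X) (x : hom P (S (base s))) (y : hom Q (S (base s))) :
  dir0 a b ∘ (mm S (base s) ∘ (x ⊗ y))
  = mm S (base t) ∘ ((dir0 a b ∘ x) ⊗ (alg_part a ∘ y))
    + mm S (base t) ∘ ((alg_part a ∘ x) ⊗ (dir0 a b ∘ y)).
Proof.
rewrite /dir0 (derive_mul (regP t)); last exact: alg_partP.
rewrite maddC -(comp_assoc _ _ (sym _ _)) -sym_natural comp_assoc.
by rewrite (cmon_comm (am_cmonoid S _)).
Qed.

Lemma dir1_act a b (P Q : X) (x : hom P (S (base s)))
    (v : hom Q (S (base s) ⊠ coeff s)) :
  dir1 a b ∘ (act s ∘ (x ⊗ v))
  = act t ∘ ((dir0 a b ∘ x) ⊗ (mod_part a ∘ v))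
    + act t ∘ ((alg_part a ∘ x) ⊗ (dir1 a b ∘ v)).
Proof.
have scalarE (y : hom (S (base s)) (S (base t)))
    (w : hom (coeff s) (S (base t) ⊠ coeff t)) :
  act t ∘ (y ⊗ w) ∘ act s = act t ∘ ((y ∘ mm S (base s)) ⊗ w) ∘ assoc_inv _ _ _.
  rewrite /free_act !comp_assoc -(comp_assoc _ (y ⊗ w)) -tensm_comp.
  by rewrite comp_idr.
have actE : dir1 a b ∘ act s
    = act t ∘ (dir0 a b ⊗ mod_part a) + act t ∘ (alg_part a ⊗ dir1 a b).
  rewrite /dir1 comp_addl !scalarE (alg_morphism_mul (alg_partP a)).
  have := dir0_mul a b 1_(_) 1_(_); rewrite tensm_id !comp_idr => ->.
  rewrite tensm_addl comp_addr comp_addl !(act_assoc (modP t)).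
  rewrite !(comp_eqr _ (assoc_invK _ _ _)) !comp_idr -mod_partE.
  by rewrite tensm_addr comp_addr maddA.
rewrite comp_assoc actE comp_addl -!(comp_assoc (act t) (_ ⊗ _)).
by rewrite -!tensm_comp.
Qed.

(** Lie derivatives commute with the exterior derivative. The second-order term of [derive_derive]
    becomes the summand of [dir1] that differentiates the coefficient; this gives the compatibility
    needed to define [dir]. *)
Lemma dir1_universal a b : dir1 a b ∘ universal s = universal t ∘ dir0 a b.
Proof.
rewrite (universalE t) /dir0.
rewrite (derive_derive _ _ (modP t) (alg_morphism_id S _) (alg_partP a)).
rewrite -universalE !comp_idl -(comp_assoc (universal t)) -!/(gen0 _).
rewrite -!gen1_form -/(dir0 a b) /derive /universal /dir1.
rewrite comp_assoc !comp_addl -!(comp_assoc (act t) (_ ⊗ _) (_ ⊗ _)).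
by rewrite -!tensm_comp !comp_idr maddC.
Qed.

Lemma dir0_eta a b : dir0 a b ∘ eta S (base s) = gen0 b.
Proof. exact/(derive_eta (regP t))/alg_partP. Qed.

(** A generator has coefficient [1], whose derivative vanishes by [dd_constant]. *)
Lemma dir1_gen_incl a b : dir1 a b ∘ gen_incl (base s) (coeff s) = gen1 b.
Proof.
have dir0_unit : dir0 a b ∘ uu S (base s) = 0.
  by rewrite /dir0 /derive -comp_assoc dd_constant comp_zeror.
rewrite /dir1 /gen_incl comp_assoc comp_addl -!(comp_assoc (act t) (_ ⊗ _)).
rewrite -!tensm_comp !comp_idr dir0_unit tensm_zerol comp_zeror madd0.
by rewrite alg_morphism_unit ?(act_unit (modP t)) //; apply: alg_partP.
Qed.

(** The derivative of [p] at the point [a] in the direction [b], with [p], [a]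
    and [b] read in the opposite category. *)
Definition dir (r : presentation) (p : Hom r s) a b : Hom r t.
Proof.
refine (@mk_hom r t (dir0 a b ∘ gen0 p) (dir1 a b ∘ gen1 p) _).
by rewrite -comp_assoc gen1_form comp_assoc dir1_universal comp_assoc.
Defined.

Lemma dir_id a b : dir (dmor_id (free_der s)) a b = b.
Proof.
have e0 : gen0 (dmor_id (free_der s)) = eta S (base s) by apply: comp_idl.
have e1 : gen1 (dmor_id (free_der s)) = gen_incl (base s) (coeff s).
  exact: comp_idl.
by apply: hom_ext; rewrite ?gen0_mk ?gen1_mk ?e0 ?e1 ?dir0_eta ?dir1_gen_incl.
Qed.

Lemma dir_lin (r : presentation) (f0 : hom (base r) (base s))
    (f1 : hom (coeff r) (coeff s)) (fP : f1 ∘ form r = form s ∘ f0) a b :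
  dir (lin_hom fP) a b = b • lin_hom fP.
Proof.
apply: hom_ext; rewrite ?gen0_comp_lin ?gen1_comp_lin ?gen0_mk ?gen1_mk.
- by rewrite comp_assoc dir0_eta.
- by rewrite comp_assoc dir1_gen_incl.
Qed.

End Direction.

Lemma dir0_comp (r s t : presentation) (a b : Hom s t) (f : Hom r s) :
  dir0 a b ∘ alg_part f = dir0 (a • f) (dir f a b).
Proof.
rewrite {1}/dir0 (derive_comp (regP t)); try exact: alg_partP.
by rewrite -(comp_assoc _ _ (eta S _)) /(dir0 _ (dir _ _ _)) gen0_mk.
Qed.

Lemma alg_part_dir0 (s t u : presentation) (q : Hom t u) (a b : Hom s t) :
  alg_part q ∘ dir0 a b = dir0 (q • a) (q • b).
Proof.
rewrite /dir0 /derive comp_assoc (comp_assoc _ (mm _ _)).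
rewrite alg_morphism_mul; last exact: alg_partP.
by rewrite -(comp_assoc (mm _ _)) -tensm_comp -gen0_comp.
Qed.

(** Naturality in point and direction; it recovers every [dir] from the one at the generic pair. *)
Lemma comp_dir (r s t u : presentation) (q : Hom t u) (p : Hom r s)
    (a b : Hom s t) :
  q • dir p a b = dir p (q • a) (q • b).
Proof.
apply: hom_ext; rewrite ?gen0_comp ?gen1_comp ?gen0_mk ?gen1_mk comp_assoc.
- by rewrite alg_part_dir0.
- congr (_ ∘ _); rewrite /dir1 comp_addr !(comp_assoc _ (act t)) !mod_part_act.
  by rewrite -!(comp_assoc (act u)) -!tensm_comp alg_part_dir0 -!gen1_comp.
Qed.

Lemma alg_part_comp (r s t : presentation) (q : Hom s t) (p : Hom r s) :
  alg_part (q • p) = alg_part q ∘ alg_part p.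
Proof. by []. Qed.

Lemma dir_comp (q r s t : presentation) (g : Hom q r) (f : Hom r s)
    (a b : Hom s t) :
  dir (f • g) a b = dir g (a • f) (dir f a b).
Proof.
apply: hom_ext; rewrite ?gen0_mk ?gen1_mk ?gen0_comp ?gen1_comp comp_assoc.
- by rewrite dir0_comp.
- by rewrite mod_partE dir1_act dir0_comp /dir1 gen1_mk gen1_comp.
Qed.

(** * Closed formulas for second derivatives *)

Section SecondDirection.
Variables (s t : presentation).
Implicit Types a b e h : Hom s t.

(** The second derivative at the point [(a, b)] in the direction [(e, h)]: a first-order term in [h]
    plus the Hessian at [a] on [b] and [e]. *)
Definition dir2_0 a b e h : hom (S (base s)) (S (base t)) :=
  dir0 a h + mm S (base t) ∘ (dir0 a b ⊗ gen0 e) ∘ dd S (base s).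

(** Leibniz rule: both derivatives fall on the coefficient, both on the generator, or one on
    each. *)
Definition dir2_1 a b e h :
  hom (S (base s) ⊠ coeff s) (S (base t) ⊠ coeff t) :=
  (act t ∘ (dir2_0 a b e h ⊗ gen1 a) + act t ∘ (alg_part a ⊗ gen1 h))
  + (act t ∘ (dir0 a b ⊗ gen1 e) + act t ∘ (dir0 a e ⊗ gen1 b)).

Lemma dir2_0_sym a b e h : dir2_0 a b e h = dir2_0 a e b h.
Proof. by rewrite /dir2_0 derive_mul_sym //; apply: alg_partP. Qed.

Lemma dir2_1_sym a b e h : dir2_1 a b e h = dir2_1 a e b h.
Proof. by rewrite /dir2_1 dir2_0_sym (maddC (act t ∘ (dir0 a b ⊗ _))). Qed.

Lemma gen0_zero : gen0 (hom_zero s t) = 0.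
Proof. exact: gen0_mk. Qed.

Lemma gen1_zero : gen1 (hom_zero s t) = 0.
Proof. exact: gen1_mk. Qed.

Lemma dir0_zero a : dir0 a (hom_zero s t) = 0.
Proof. by rewrite /dir0 /derive gen0_zero tensm_zeror comp_zeror comp_zerol. Qed.

Lemma dir2_0_zero a b h : dir2_0 a b (hom_zero s t) h = dir0 a h.
Proof.
by rewrite /dir2_0 gen0_zero tensm_zeror comp_zeror comp_zerol maddr0.
Qed.

Lemma dir2_1_zero a b h : dir2_1 a b (hom_zero s t) h = dir1 a h.
Proof.
rewrite /dir2_1 dir2_0_zero dir0_zero gen1_zero tensm_zerol tensm_zeror.
by rewrite !comp_zeror !maddr0.
Qed.

End SecondDirection.

Section Composites.
Variables (s t u : presentation) (i j : Hom s t) (A B : Hom t u).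

(** Intended for the two injections [i], [j] into a sum, whose composites with [A] are the original
    point and direction. *)
Lemma dir0_dir0 :
  dir0 A B ∘ dir0 i j = dir2_0 (A • i) (A • j) (dir i A B) (dir j A B).
Proof.
rewrite {1 2}/dir0 (derive_derive _ _ (regP u)); try exact: alg_partP.
rewrite -alg_part_comp -gen0_comp -(comp_assoc (derive _ _ _)) -!/(gen0 _).
by rewrite /dir2_0 /dir0 !gen0_mk.
Qed.

Lemma dir1_dir1 :
  dir1 A B ∘ dir1 i j = dir2_1 (A • i) (A • j) (dir i A B) (dir j A B).
Proof.
rewrite {2}/dir1 comp_addr !dir1_act dir0_dir0 dir0_comp.
rewrite alg_part_dir0 (maddC (act u ∘ (dir0 _ (dir i _ _) ⊗ _))) maddACA.
by rewrite /dir2_1 !gen1_mk !gen1_comp.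
Qed.

End Composites.

(** * The category of presentations *)

Definition free_ob (t : presentation) : S_DER_free S :=
  exist (@is_free _ _ _ S) (free_der t)
    (ex_intro _ _ (ex_intro _ _ (ex_intro _ (form t) erefl))).

Lemma free_ob_surj (A : S_DER_free S) : exists t, free_ob t = A.
Proof.
case: A => -[E EP] Efree; have /= [A0 [A1 [phi eE]]] := Efree.
exists {| form := phi |}; rewrite /= in eE; subst E; rewrite /free_ob /free_der.
have <- : free_derivationP {| form := phi |} = EP by apply: proof_irrelevance.
by congr exist; apply: proof_irrelevance.
Qed.

Definition free_category : Category :=
  opposite (induced_category free_ob).

(** * Products from biproducts, and the differential combinator *)

Section Biproducts.
Variable bip : FiniteBiproducts X.

Local Notation ι1 := (binj1 bip _ _).
Local Notation ι2 := (binj2 bip _ _).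
Local Notation π1 := (bproj1 bip _ _).
Local Notation π2 := (bproj2 bip _ _).

Definition copairing (A B Z : X) (f : hom A Z) (g : hom B Z) :
  hom (biprod bip A B) Z := f ∘ π1 + g ∘ π2.

Lemma copairing_inj1 (A B Z : X) (f : hom A Z) (g : hom B Z) :
  copairing f g ∘ ι1 = f.
Proof.
rewrite /copairing comp_addl -!comp_assoc bproj1_inj1 bproj2_inj1.
by rewrite comp_idr comp_zeror maddr0.
Qed.

Lemma copairing_inj2 (A B Z : X) (f : hom A Z) (g : hom B Z) :
  copairing f g ∘ ι2 = g.
Proof.
rewrite /copairing comp_addl -!comp_assoc bproj1_inj2 bproj2_inj2.
by rewrite comp_idr comp_zeror madd0.
Qed.

Lemma copairing_unique (A B Z : X) (h : hom (biprod bip A B) Z) :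
  h = copairing (h ∘ ι1) (h ∘ ι2).
Proof.
by rewrite /copairing -!comp_assoc -comp_addr biprod_id comp_idr.
Qed.

Lemma comp_copairing (A B Y Z : X) (k : hom Y Z) (f : hom A Y) (g : hom B Y) :
  k ∘ copairing f g = copairing (k ∘ f) (k ∘ g).
Proof. by rewrite /copairing comp_addr !comp_assoc. Qed.

(** The form is the direct sum of the two forms. This is a coproduct of free derivations, hence a
    product in the opposite category. *)
Definition sum_pres (s t : presentation) : presentation :=
  {| form := copairing (ι1 ∘ form s) (ι2 ∘ form t) |}.

Definition inl_hom (s t : presentation) : Hom s (sum_pres s t) :=
  lin_hom (t := sum_pres s t) (esym (copairing_inj1 (ι1 ∘ form s) (ι2 ∘ form t))).

Definition inr_hom (s t : presentation) : Hom t (sum_pres s t) :=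
  lin_hom (t := sum_pres s t) (esym (copairing_inj2 (ι1 ∘ form s) (ι2 ∘ form t))).

Definition copair_hom (s t r : presentation) (f : Hom s r) (g : Hom t r) :
  Hom (sum_pres s t) r.
Proof.
refine (@mk_hom (sum_pres s t) r (copairing (gen0 f) (gen0 g))
  (copairing (gen1 f) (gen1 g)) _).
by rewrite !comp_copairing -!gen1_form !comp_assoc copairing_inj1 copairing_inj2.
Defined.

Lemma copair_inl (s t r : presentation) (f : Hom s r) (g : Hom t r) :
  copair_hom f g • inl_hom s t = f.
Proof.
by apply: hom_ext; rewrite ?gen0_comp_lin ?gen1_comp_lin ?gen0_mk ?gen1_mk
  copairing_inj1.
Qed.

Lemma copair_inr (s t r : presentation) (f : Hom s r) (g : Hom t r) :
  copair_hom f g • inr_hom s t = g.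
Proof.
by apply: hom_ext; rewrite ?gen0_comp_lin ?gen1_comp_lin ?gen0_mk ?gen1_mk
  copairing_inj2.
Qed.

Lemma copair_unique (s t r : presentation) (h : Hom (sum_pres s t) r) :
  h = copair_hom (h • inl_hom s t) (h • inr_hom s t).
Proof.
by apply: hom_ext; rewrite ?gen0_mk ?gen1_mk ?gen0_comp_lin ?gen1_comp_lin
  -copairing_unique.
Qed.

Definition zero_pres : presentation :=
  {| form := (0 : hom (zero_ob bip) (zero_ob bip)) |}.

Lemma zero_ob_hom (A : X) (f : hom (zero_ob bip) A) : f = 0.
Proof. by rewrite -(comp_idr f) zero_ob_id comp_zeror. Qed.

Definition free_products : FiniteProducts free_category.
Proof.
refine (@Build_FiniteProducts free_category zero_pres
  (fun t => hom_zero zero_pres t) _ sum_pres inl_hom inr_hom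
  (fun r s t f g => copair_hom f g) _ _ _).
- by move=> t f; apply: hom_ext; rewrite [LHS]zero_ob_hom [RHS]zero_ob_hom.
- by move=> r s t f g; apply: copair_inl.
- by move=> r s t f g; apply: copair_inr.
- by move=> r s t h; apply: copair_unique.
Defined.

Definition free_left_additive : CartesianLeftAdditive free_category.
Proof.
refine (@Build_CartesianLeftAdditive free_category free_products
  (fun s t p q => hom_add p q) (fun s t => hom_zero t s) _ _ _ _ _ _ _ _ _).
- by move=> s t p q r; apply: hom_ext; rewrite ?gen0_mk ?gen1_mk ?maddA.
- by move=> s t p q; apply: hom_ext; rewrite ?gen0_mk ?gen1_mk maddC.
- by move=> s t p; apply: hom_ext; rewrite ?gen0_mk ?gen1_mk madd0.
- move=> r s t f g h /=; apply: hom_ext;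
    rewrite ?gen0_comp ?gen1_comp ?gen0_mk ?gen1_mk ?gen0_comp ?gen1_comp;
    exact: comp_addr.
- move=> r s t h /=; apply: hom_ext;
    rewrite ?gen0_comp ?gen1_comp ?gen0_mk ?gen1_mk; exact: comp_zeror.
- move=> r s t f g /=; apply: hom_ext;
    rewrite ?gen0_comp_lin ?gen1_comp_lin ?gen0_mk ?gen1_mk
      ?gen0_comp_lin ?gen1_comp_lin; exact: comp_addl.
- move=> r s t f g /=; apply: hom_ext;
    rewrite ?gen0_comp_lin ?gen1_comp_lin ?gen0_mk ?gen1_mk
      ?gen0_comp_lin ?gen1_comp_lin; exact: comp_addl.
- move=> r s t /=; apply: hom_ext;
    rewrite ?gen0_comp_lin ?gen1_comp_lin ?gen0_mk ?gen1_mk; exact: comp_zerol.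
- move=> r s t /=; apply: hom_ext;
    rewrite ?gen0_comp_lin ?gen1_comp_lin ?gen0_mk ?gen1_mk; exact: comp_zerol.
Defined.

(** [dir] at the generic point and direction, namely the two projections of the opposite
    category. *)
Definition free_combinator (s t : free_category) (f : @hom free_category s t) :
  @hom free_category (sum_pres s s) t := dir f (inl_hom s s) (inr_hom s s).

Lemma copair_free_combinator (s t r : presentation) (f : Hom t s)
    (a b : Hom s r) :
  copair_hom a b • free_combinator f = dir f a b.
Proof. by rewrite /free_combinator comp_dir copair_inl copair_inr. Qed.

Lemma copair_second_combinator (s t r : presentation) (f : Hom t s)
    (a b e h : Hom s r) :
  copair_hom (copair_hom a b) (copair_hom e h)
    • free_combinator (free_combinator f)
  = dir (free_combinator f) (copair_hom a b) (copair_hom e h).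
Proof. exact: copair_free_combinator. Qed.

(** [dir0_dir0] at the injections; as these are linear, [dir_lin] turns its last two arguments into
    [e] and [h]. *)
Lemma dir_free_combinator_gen0 (s t r : presentation) (f : Hom t s)
    (a b e h : Hom s r) :
  gen0 (dir (free_combinator f) (copair_hom a b) (copair_hom e h))
  = dir2_0 a b e h ∘ gen0 f.
Proof.
rewrite !gen0_mk comp_assoc dir0_dir0 !copair_inl !copair_inr.
by rewrite !dir_lin !copair_inl !copair_inr.
Qed.

Lemma dir_free_combinator_gen1 (s t r : presentation) (f : Hom t s)
    (a b e h : Hom s r) :
  gen1 (dir (free_combinator f) (copair_hom a b) (copair_hom e h))
  = dir2_1 a b e h ∘ gen1 f.
Proof.
rewrite !gen1_mk comp_assoc dir1_dir1 !copair_inl !copair_inr.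
by rewrite !dir_lin !copair_inl !copair_inr.
Qed.

Lemma dir0_add (s t : presentation) (a b b' : Hom s t) :
  dir0 a (hom_add b b') = dir0 a b + dir0 a b'.
Proof. by rewrite /dir0 /derive gen0_mk tensm_addr comp_addr comp_addl. Qed.

Lemma dir1_add (s t : presentation) (a b b' : Hom s t) :
  dir1 a (hom_add b b') = dir1 a b + dir1 a b'.
Proof.
rewrite /dir1 dir0_add gen1_mk tensm_addl tensm_addr !comp_addr.
exact: maddACA.
Qed.

Lemma dir1_zero (s t : presentation) (a : Hom s t) :
  dir1 a (hom_zero s t) = 0.
Proof.
by rewrite /dir1 dir0_zero gen1_zero tensm_zerol tensm_zeror !comp_zeror madd0.
Qed.

Lemma free_combinatorP :
  is_differential_combinator (L := free_left_additive) free_combinator.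
Proof.
split=> [s t f g|s t|r s t f a b b'|r s t f a|s|s t|s t|r s t f g|q s t g f
  |r s t f a b e|r s t f a b e h].
- by apply: hom_ext; rewrite ?gen0_mk ?gen1_mk comp_addr.
- by apply: hom_ext; rewrite ?gen0_mk ?gen1_mk comp_zeror.
- transitivity (hom_add (dir f a b) (dir f a b')); last first.
    by congr hom_add; apply/esym/copair_free_combinator.
  rewrite [LHS]copair_free_combinator; apply: hom_ext;
    rewrite ?gen0_mk ?gen1_mk ?dir0_add ?dir1_add; exact: comp_addl.
- rewrite [LHS]copair_free_combinator; apply: hom_ext;
    rewrite ?gen0_mk ?gen1_mk ?dir0_zero ?dir1_zero; exact: comp_zerol.
- exact: dir_id.
- exact: dir_lin.
- exact: dir_lin.
- by apply: hom_ext; rewrite ?gen0_mk ?gen1_mk comp_copairing.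
- rewrite [RHS]copair_free_combinator; exact: dir_comp.
(* The last two axioms are read off the closed formulas: the Hessian and cross terms vanish for a
   zero third argument, and the formulas are symmetric in the middle two. *)
- rewrite [LHS]copair_second_combinator [RHS]copair_free_combinator.
  apply: hom_ext; rewrite ?dir_free_combinator_gen0 ?dir_free_combinator_gen1.
  + by rewrite dir2_0_zero gen0_mk.
  + by rewrite dir2_1_zero gen1_mk.
- rewrite [LHS]copair_second_combinator [RHS]copair_second_combinator.
  apply: hom_ext; rewrite !(dir_free_combinator_gen0, dir_free_combinator_gen1).
  + by rewrite dir2_0_sym.
  + by rewrite dir2_1_sym.
Qed.

Definition free_cartesian_differential : CartesianDifferential free_category :=
  Build_CartesianDifferential free_combinatorP.

End Biproducts.

End FreeDerivations.

Theorem corollary8p4 (X : Category) (addX : Additive X)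
    (monX : SymmetricMonoidal X) (asmX : AdditiveSymmetricMonoidal addX monX)
    (bipX : FiniteBiproducts X) (S : DifferentialModality X) :
  inhabited (CartesianDifferential (opposite (S_DER_free S))).
Proof.
apply: (cartesian_differential_surj (@free_ob_surj _ _ _ S)).
exact: free_cartesian_differential.
Qed.
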